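(* Let $p>1$ and $\lambda>0$. Then the equation $$u''-uu'+u|u|^{p-1}-\lambda u=0$$ admits: (1) a positive solution $u$ in $(-\infty,0]$ satisfying $u'(-\infty)=u'(0)=0$; (2) a positive solution $v$ in $(-\infty,0]$ satisfying $v'(-\infty)=v(0)=0$; (3) a sign-changing solution $w$ in $\mathbb{R}$ satisfying $w'(-\infty)=w'(\infty)=0$; (4) a negative solution $z$ in $[0,\infty)$ satisfying $z(0)=z'(\infty)=0$.
   Context: A solution is a real-valued function of class $\mathcal{C}^2$ satisfying the equation in the classical sense. Values at $\pm\infty$ denote limits, e.g. $u'(-\infty)=\lim_{x\to-\infty}u'(x)$. Positive (resp. negative) means $>0$ (resp. $<0$) in the interior of the interval; sign-changing means taking both positive and negative values. *)

(* Defs.v *)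
From Stdlib Require Import Reals.
From Coquelicot Require Import Coquelicot.
Open Scope R_scope.

(* |x|^a for a > 0.  The case x = 0 is separate because [Rpower 0 a] is a junk
   value ([ln 0 = 0], hence [Rpower 0 a = 1]). *)
Definition abs_pow (x a : R) : R :=
  if Req_EM_T x 0 then 0 else Rpower (Rabs x) a.

(* [D_in] and [continue_in] only look at points of [I], so at an endpoint
   belonging to [I] derivatives and continuity are one-sided. *)
Definition C2_on (I : R -> Prop) (u u' u'' : R -> R) : Prop :=
  (forall x, I x -> D_in u u' I x) /\
  (forall x, I x -> D_in u' u'' I x) /\
  (forall x, I x -> continue_in u'' I x).

(* [u] is a classical solution on [I], with derivative [u'] there.  On a
   nondegenerate interval [u'] is determined on [I] by [u]. *)
Definition solution_on (p lambda : R) (I : R -> Prop) (u u' : R -> R) : Prop :=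
  exists u'' : R -> R,
    C2_on I u u' u'' /\
    forall x, I x ->
      u'' x - u x * u' x + u x * abs_pow (u x) (p - 1) - lambda * u x = 0.

Definition positive_on (I : R -> Prop) (u : R -> R) : Prop :=
  forall x, interior I x -> 0 < u x.

Definition negative_on (I : R -> Prop) (u : R -> R) : Prop :=
  forall x, interior I x -> u x < 0.

Definition sign_changing_on (I : R -> Prop) (u : R -> R) : Prop :=
  (exists x, I x /\ 0 < u x) /\ (exists x, I x /\ u x < 0).

Definition nonpos_line (x : R) : Prop := x <= 0.
Definition nonneg_line (x : R) : Prop := 0 <= x.
Definition whole_line (x : R) : Prop := True.

(* Main.v *)
Require Import Defs.
From Stdlib Require Import Reals Lra Lia Classical.
From Coquelicot Require Import Coquelicot.
Open Scope R_scope.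

(* The substitution (x, u) -> (-x, -u) preserves the equation, so (3) and (4)
   follow from (2) by odd reflection, and (1) is satisfied by the constant
   lambda^(1/(p-1)).  For (2), y(t) = v(-t) solves the oscillator
     y'' = lambda y - y^p - y y',   y(0) = 0,  y'(0) = s > 0,
   which is damped where y > 0: with w = y', the energy
     E = w^2/2 + y^(p+1)/(p+1) - lambda y^2/2
   satisfies E' = - y w^2.  If s is small, the orbit loses more than the initial
   energy s^2/2 while y climbs to the height delta = (lambda/2)^(1/(p-1)), so E
   becomes negative.  As E >= 0 when y = 0 or y = M = ((p+1) lambda/2)^(1/(p-1)),
   y then stays in (0, M), bounded away from 0, and the remaining dissipation
   forces w -> 0.  Orbits come from Picard iteration for a field truncated
   outside |y| <= M. *)

(** * Picard iteration for planar systems *)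

Lemma continuous_eps (f : R -> R) (t : R) :
  continuous f t <->
  forall eps, 0 < eps -> locally t (fun s => Rabs (f s - f t) < eps).
Proof.
  unfold continuous; rewrite filterlim_locally; split.
  - intros H eps He. exact (H (mkposreal eps He)).
  - intros H [eps He]. exact (H eps He).
Qed.

Lemma continuous_Rbound (f h : R -> R) (t : R) :
  continuous h t -> h t = 0 -> (forall s, Rabs (f s - f t) <= h s) ->
  continuous f t.
Proof.
  rewrite !continuous_eps; intros Hh H0 Hb eps He.
  generalize (Hh eps He); apply filter_imp; intros s Hs.
  rewrite H0 in Hs. specialize (Hb s).
  rewrite Rminus_0_r in Hs. pose proof (Rle_abs (h s)). lra.
Qed.

(** Integrating an exponential of rate [a] divides it by [a]. With [a] proportional to the Lipschitz
    constant, this gain makes the integral operator contract on the whole half-line. *)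
Lemma RInt_exp_bound (h : R -> R) (a K t : R) :
  0 < a -> 0 <= K -> 0 <= t -> (forall s, continuous h s) ->
  (forall s, 0 <= s -> Rabs (h s) <= K * exp (a * s)) ->
  Rabs (RInt h 0 t) <= K / a * exp (a * t).
Proof.
  intros Ha HK Ht Hc Hb.
  assert (Hint : is_RInt (fun s => K * exp (a * s)) 0 t
                   (K / a * exp (a * t) - K / a * exp (a * 0))).
  { apply (is_RInt_derive (fun s => K / a * exp (a * s)));
      intros s _.
    - auto_derive; [easy | field; lra].
    - apply (ex_derive_continuous (V := R_NormedModule)). auto_derive. easy. }
  assert (Hh : is_RInt h 0 t (RInt h 0 t)).
  { apply (RInt_correct (V := R_CompleteNormedModule)).
    apply (ex_RInt_continuous (V := R_CompleteNormedModule)). auto. }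
  pose proof (norm_RInt_le h _ 0 t _ _ Ht (fun s Hs => Hb s (proj1 Hs)) Hh Hint)
    as Hn.
  change (norm (RInt h 0 t)) with (Rabs (RInt h 0 t)) in Hn.
  rewrite Rmult_0_r, exp_0 in Hn.
  assert (0 <= K / a) by (apply Rdiv_le_0_compat; lra). lra.
Qed.

Lemma is_derive_RInt_continuous (h : R -> R) (t : R) :
  (forall s, continuous h s) -> is_derive (fun t => RInt h 0 t) t (h t).
Proof.
  intros Hc. apply (is_derive_RInt (V := R_NormedModule) h _ 0); [ | auto].
  apply filter_forall; intros b.
  apply (RInt_correct (V := R_CompleteNormedModule)).
  apply (ex_RInt_continuous (V := R_CompleteNormedModule)). auto.
Qed.

(** The l1 distance is chosen because bounds on the two coordinates simply add: each coordinate
    contributes half of the contraction factor. *)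
Definition dist1 (P Q : R * R) : R :=
  Rabs (fst P - fst Q) + Rabs (snd P - snd Q).

Definition Lipschitz1 (L : R) (F : R * R -> R) : Prop :=
  forall P Q, Rabs (F P - F Q) <= L * dist1 P Q.

Definition planar_continuous (X : R -> R * R) : Prop :=
  forall t, continuous (fun s => fst (X s)) t /\ continuous (fun s => snd (X s)) t.

Lemma dist1_sym (P Q : R * R) : dist1 P Q = dist1 Q P.
Proof. unfold dist1. now rewrite (Rabs_minus_sym (fst P)), (Rabs_minus_sym (snd P)). Qed.

Lemma dist1_triangle (P Q S : R * R) : dist1 P S <= dist1 P Q + dist1 Q S.
Proof.
  unfold dist1.
  pose proof (Rabs_triang (fst P - fst Q) (fst Q - fst S)).
  pose proof (Rabs_triang (snd P - snd Q) (snd Q - snd S)).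
  replace (fst P - fst S) with (fst P - fst Q + (fst Q - fst S)) by ring.
  replace (snd P - snd S) with (snd P - snd Q + (snd Q - snd S)) by ring.
  lra.
Qed.

Lemma Lipschitz1_continuous (L : R) (F : R * R -> R) (X : R -> R * R) :
  Lipschitz1 L F -> planar_continuous X -> forall t, continuous (fun s => F (X s)) t.
Proof.
  intros HF HX t. destruct (HX t) as [H1 H2].
  apply (continuous_Rbound _ (fun s => L * dist1 (X s) (X t))); [ | | intros s; apply HF].
  - unfold dist1.
    apply (continuous_mult (K := R_AbsRing) (fun _ => L)); [apply continuous_const | ].
    apply (continuous_plus (V := R_NormedModule));
      apply continuous_comp; try apply continuous_Rabs;
      apply (continuous_minus (V := R_NormedModule)); auto; apply continuous_const.
  - unfold dist1. rewrite !Rminus_diag, Rabs_R0. ring.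
Qed.

Section Picard.

Variables (F G : R * R -> R) (L : R) (P0 : R * R).
Hypotheses (HL : 0 < L) (HF : Lipschitz1 L F) (HG : Lipschitz1 L G).

(* Iterates are made even in time, so that they live on all of R while the
   equation is only meant for t >= 0. *)
Definition picard_step (X : R -> R * R) (t : R) : R * R :=
  (fst P0 + RInt (fun s => F (X s)) 0 (Rabs t),
   snd P0 + RInt (fun s => G (X s)) 0 (Rabs t)).

(** Bielecki's weight. In the sup norm weighted by its inverse the Picard operator contracts with
    factor 1/2 on all of R at once, so no local solutions have to be patched together. *)
Definition weight (t : R) : R := exp (4 * L * Rabs t).

Lemma weight_pos t : 0 < weight t.
Proof. apply exp_pos. Qed.

Lemma continuous_RInt_Rabs (h : R -> R) (c t : R) :
  (forall s, continuous h s) -> continuous (fun t => c + RInt h 0 (Rabs t)) t.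
Proof.
  intros Hc. apply (continuous_plus (V := R_NormedModule)); [apply continuous_const | ].
  apply (continuous_comp Rabs (fun t => RInt h 0 t)); [apply continuous_Rabs | ].
  apply (ex_derive_continuous (V := R_NormedModule)).
  eexists. now apply is_derive_RInt_continuous.
Qed.

Lemma picard_step_continuous X : planar_continuous X -> planar_continuous (picard_step X).
Proof.
  intros HX t; split; simpl; apply continuous_RInt_Rabs;
    eapply Lipschitz1_continuous; eauto.
Qed.

(** The Lipschitz bound costs a factor [L] and the integration against the weight gains [4 * L],
    which leaves 1/4 per coordinate. *)
Lemma RInt_Lipschitz1_bound (H : R * R -> R) X Y K t :
  Lipschitz1 L H -> planar_continuous X -> planar_continuous Y -> 0 <= K ->
  (forall s, dist1 (X s) (Y s) <= K * weight s) ->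
  Rabs (RInt (fun s => H (X s)) 0 (Rabs t) - RInt (fun s => H (Y s)) 0 (Rabs t))
    <= K / 4 * weight t.
Proof.
  intros HH HX HY HK Hd.
  pose proof (Lipschitz1_continuous _ _ _ HH HX) as CX.
  pose proof (Lipschitz1_continuous _ _ _ HH HY) as CY.
  assert (E : RInt (fun s => H (X s) - H (Y s)) 0 (Rabs t) =
     RInt (fun s => H (X s)) 0 (Rabs t) - RInt (fun s => H (Y s)) 0 (Rabs t)).
  { apply (RInt_minus (V := R_CompleteNormedModule));
      apply (ex_RInt_continuous (V := R_CompleteNormedModule)); auto. }
  rewrite <- E.
  replace (K / 4 * weight t) with (L * K / (4 * L) * exp (4 * L * Rabs t))
    by (unfold weight; field; lra).
  apply RInt_exp_bound; try nra; [apply Rabs_pos | | ].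
  - intros s. apply (continuous_minus (V := R_NormedModule)); auto.
  - intros s Hs. apply Rle_trans with (1 := HH _ _).
    specialize (Hd s). unfold weight in Hd. rewrite Rabs_pos_eq in Hd by easy.
    rewrite Rmult_assoc. apply Rmult_le_compat_l; lra.
Qed.

Lemma picard_step_contract X Y K t :
  planar_continuous X -> planar_continuous Y -> 0 <= K ->
  (forall s, dist1 (X s) (Y s) <= K * weight s) ->
  dist1 (picard_step X t) (picard_step Y t) <= K / 2 * weight t.
Proof.
  intros HX HY HK Hd.
  pose proof (RInt_Lipschitz1_bound F X Y K t HF HX HY HK Hd).
  pose proof (RInt_Lipschitz1_bound G X Y K t HG HX HY HK Hd).
  unfold dist1, picard_step; simpl.
  match goal with |- Rabs ?a + Rabs ?b <= _ =>
    match type of H with Rabs ?c <= _ => replace a with c by ring end;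
    match type of H0 with Rabs ?c <= _ => replace b with c by ring end end.
  lra.
Qed.

Fixpoint picard (n : nat) : R -> R * R :=
  match n with O => fun _ => P0 | S n => picard_step (picard n) end.

Lemma picard_continuous n : planar_continuous (picard n).
Proof.
  induction n; simpl; [intros t; split; apply continuous_const | ].
  now apply picard_step_continuous.
Qed.

(** The first iterate moves by [Rabs t] times the size of the field at [P0], and
    [Rabs t <= weight t / (4 * L)]. *)
Definition picard_cst : R := (Rabs (F P0) + Rabs (G P0)) / (4 * L).

Lemma picard_cst_pos : 0 <= picard_cst.
Proof.
  apply Rdiv_le_0_compat; [ | lra].
  pose proof (Rabs_pos (F P0)). pose proof (Rabs_pos (G P0)). lra.
Qed.

Lemma picard_succ n t :
  dist1 (picard (S n) t) (picard n t) <= picard_cst / 2 ^ n * weight t.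
Proof.
  revert t; induction n; intros t.
  - unfold dist1, picard_cst; simpl.
    rewrite !RInt_const.
    unfold scal; simpl; unfold mult; simpl.
    rewrite Rminus_0_r.
    replace (fst P0 + Rabs t * F P0 - fst P0) with (Rabs t * F P0) by ring.
    replace (snd P0 + Rabs t * G P0 - snd P0) with (Rabs t * G P0) by ring.
    rewrite !Rabs_mult, Rabs_Rabsolu.
    pose proof (exp_ineq1_le (4 * L * Rabs t)) as He.
    pose proof (Rabs_pos (F P0)). pose proof (Rabs_pos (G P0)). pose proof (Rabs_pos t).
    unfold weight.
    apply Rle_trans with ((Rabs (F P0) + Rabs (G P0)) / (4 * L) / 1 * (4 * L * Rabs t)).
    + right; field; lra.
    + apply Rmult_le_compat_l; [ | lra].
      unfold Rdiv at 1. rewrite Rinv_1, Rmult_1_r.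
      apply Rdiv_le_0_compat; lra.
  - replace (picard_cst / 2 ^ S n) with (picard_cst / 2 ^ n / 2)
      by (simpl; field; apply pow_nonzero; lra).
    apply (picard_step_contract (picard (S n)) (picard n));
      auto using picard_continuous.
    apply Rdiv_le_0_compat; [apply picard_cst_pos | apply pow_lt; lra].
Qed.

(** Telescoping sum of the geometric bounds. The subtracted tail is kept because without it the
    induction on [k] would not close. *)
Lemma picard_add n k t :
  dist1 (picard (n + k) t) (picard n t) <=
    (2 * picard_cst / 2 ^ n - 2 * picard_cst / 2 ^ (n + k)) * weight t.
Proof.
  induction k.
  - rewrite Nat.add_0_r. unfold dist1. rewrite !Rminus_diag, Rabs_R0. lra.
  - rewrite Nat.add_succ_r.
    apply Rle_trans with (1 := dist1_triangle _ (picard (n + k) t) _).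
    pose proof (picard_succ (n + k) t) as Hs.
    replace (2 * picard_cst / 2 ^ S (n + k)) with (picard_cst / 2 ^ (n + k))
      by (simpl; field; apply pow_nonzero; lra).
    replace (2 * picard_cst / 2 ^ (n + k)) with
      (picard_cst / 2 ^ (n + k) + picard_cst / 2 ^ (n + k)) in IHk
      by (field; apply pow_nonzero; lra).
    lra.
Qed.

Lemma picard_add_le n k t :
  dist1 (picard (n + k) t) (picard n t) <= 2 * picard_cst / 2 ^ n * weight t.
Proof.
  apply Rle_trans with (1 := picard_add n k t).
  apply Rmult_le_compat_r; [left; apply weight_pos | ].
  assert (0 <= 2 * picard_cst / 2 ^ (n + k)); [ | lra].
  apply Rdiv_le_0_compat; [pose proof picard_cst_pos; lra | apply pow_lt; lra].
Qed.

Lemma geometric_small (K eps : R) : 0 < eps -> exists n, K / 2 ^ n < eps.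
Proof.
  intros He.
  destruct (Pow_x_infinity 2) with (b := Rabs K / eps + 1) as [n Hn].
  { rewrite Rabs_pos_eq; lra. }
  exists n. specialize (Hn n (Nat.le_refl n)).
  assert (Hp : 0 < 2 ^ n) by (apply pow_lt; lra).
  rewrite Rabs_pos_eq in Hn by lra.
  apply Rmult_lt_reg_r with (2 ^ n); [easy | ].
  replace (K / 2 ^ n * 2 ^ n) with K by (field; lra).
  pose proof (Rle_abs K).
  replace (Rabs K) with (eps * (Rabs K / eps)) in H by (field; lra).
  nra.
Qed.

(** The iterates are Cauchy at each [t]. Taking any 1-Lipschitz [c] treats [fst] and [snd]
    together. *)
Lemma coordinate_limit (c : R * R -> R) t :
  (forall P Q, Rabs (c P - c Q) <= dist1 P Q) ->
  ex_finite_lim_seq (fun n => c (picard n t)).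
Proof.
  intros Hc. apply ex_lim_seq_cauchy_corr. intros [eps He]; simpl.
  destruct (geometric_small (2 * picard_cst * weight t) (eps / 2)) as [N HN]; [lra | ].
  exists N. intros n m Hn Hm.
  assert (Hk : forall n, (N <= n)%nat -> Rabs (c (picard n t) - c (picard N t)) < eps / 2).
  { intros k Hk. apply Rle_lt_trans with (1 := Hc _ _).
    replace k with (N + (k - N))%nat by lia.
    apply Rle_lt_trans with (1 := picard_add_le _ _ _).
    apply Rle_lt_trans with (2 := HN). right; field. apply pow_nonzero; lra. }
  pose proof (Hk n Hn). pose proof (Hk m Hm).
  replace (c (picard n t) - c (picard m t)) with
    ((c (picard n t) - c (picard N t)) - (c (picard m t) - c (picard N t))) by ring.
  apply Rle_lt_trans with (1 := Rabs_triang _ _). rewrite Rabs_Ropp. lra.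
Qed.

Definition picard_lim (t : R) : R * R :=
  (real (Lim_seq (fun n => fst (picard n t))),
   real (Lim_seq (fun n => snd (picard n t)))).

Lemma picard_lim_bound n t :
  dist1 (picard_lim t) (picard n t) <= 2 * picard_cst / 2 ^ n * weight t.
Proof.
  assert (H1 : is_lim_seq (fun n => fst (picard n t)) (fst (picard_lim t))).
  { apply Lim_seq_correct', coordinate_limit. intros P Q. unfold dist1.
    pose proof (Rabs_pos (snd P - snd Q)). lra. }
  assert (H2 : is_lim_seq (fun n => snd (picard n t)) (snd (picard_lim t))).
  { apply Lim_seq_correct', coordinate_limit. intros P Q. unfold dist1.
    pose proof (Rabs_pos (fst P - fst Q)). lra. }
  assert (H : is_lim_seq (fun k => dist1 (picard (k + n) t) (picard n t))
                         (dist1 (picard_lim t) (picard n t))).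
  { unfold dist1. apply (is_lim_seq_incr_n _ n) in H1, H2.
    apply is_lim_seq_plus'; apply (is_lim_seq_abs _ (Finite _));
      apply is_lim_seq_minus'; auto; apply is_lim_seq_const. }
  apply (is_lim_seq_le (fun k => dist1 (picard (k + n) t) (picard n t))
           (fun _ => 2 * picard_cst / 2 ^ n * weight t)
           (Finite _) (Finite _)); [ | exact H | apply is_lim_seq_const].
  intros k. rewrite Nat.add_comm. apply picard_add_le.
Qed.

Lemma continuous_coordinate (c : R * R -> R) :
  (forall P Q, Rabs (c P - c Q) <= dist1 P Q) ->
  (forall n t, continuous (fun s => c (picard n s)) t) ->
  forall t, continuous (fun s => c (picard_lim s)) t.
Proof.
  intros Hc Hn t. apply continuous_eps. intros eps He.
  (* [W] dominates the weight within distance 1 of [t], so the convergence is uniform there and the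
     usual argument with three times [eps / 3] applies. *)
  set (W := exp (4 * L * (Rabs t + 1))).
  destruct (geometric_small (2 * picard_cst * W) (eps / 3)) as [n Hsmall]; [lra | ].
  specialize (Hn n t). rewrite continuous_eps in Hn.
  assert (Hnear : locally t (fun s => Rabs (s - t) < 1)).
  { exists (mkposreal 1 Rlt_0_1). intros s Hs. exact Hs. }
  assert (Hclose : forall s, Rabs s <= Rabs t + 1 ->
                   Rabs (c (picard_lim s) - c (picard n s)) < eps / 3).
  { intros s Hs. apply Rle_lt_trans with (1 := Hc _ _).
    apply Rle_lt_trans with (1 := picard_lim_bound n s).
    apply Rle_lt_trans with (2 := Hsmall).
    replace (2 * picard_cst * W / 2 ^ n) with (2 * picard_cst / 2 ^ n * W)
      by (field; apply pow_nonzero; lra).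
    apply Rmult_le_compat_l.
    - apply Rdiv_le_0_compat; [pose proof picard_cst_pos; lra | apply pow_lt; lra].
    - unfold weight, W. destruct Hs as [Hs | Hs]; [left | right].
      + apply exp_increasing. apply Rmult_lt_compat_l; lra.
      + now rewrite Hs. }
  specialize (Hn (eps / 3) ltac:(lra)).
  generalize (filter_and _ _ Hn Hnear); apply filter_imp. intros s [Hs1 Hs2].
  assert (Rabs s <= Rabs t + 1).
  { pose proof (Rabs_triang t (s - t)). rewrite Rplus_minus in H. lra. }
  pose proof (Hclose s H). pose proof (Hclose t ltac:(lra)).
  replace (c (picard_lim s) - c (picard_lim t)) with
    ((c (picard_lim s) - c (picard n s)) + (c (picard n s) - c (picard n t))
     - (c (picard_lim t) - c (picard n t))) by ring.
  apply Rle_lt_trans with (1 := Rabs_triang _ _). rewrite Rabs_Ropp.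
  pose proof (Rabs_triang (c (picard_lim s) - c (picard n s)) (c (picard n s) - c (picard n t))).
  lra.
Qed.

Lemma picard_lim_continuous : planar_continuous picard_lim.
Proof.
  intros t; split; revert t.
  - apply (continuous_coordinate fst); [ | intros n t; apply picard_continuous].
    intros P Q. unfold dist1. pose proof (Rabs_pos (snd P - snd Q)). lra.
  - apply (continuous_coordinate snd); [ | intros n t; apply picard_continuous].
    intros P Q. unfold dist1. pose proof (Rabs_pos (fst P - fst Q)). lra.
Qed.

Lemma dist1_eq0 P Q : dist1 P Q <= 0 -> P = Q.
Proof.
  unfold dist1. intros H.
  pose proof (Rabs_pos (fst P - fst Q)). pose proof (Rabs_pos (snd P - snd Q)).
  destruct P as [a b], Q as [a' b']; simpl in *.
  assert (Ha : Rabs (a - a') = 0) by lra. assert (Hb : Rabs (b - b') = 0) by lra.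
  apply Rabs_eq_0 in Ha. apply Rabs_eq_0 in Hb. f_equal; lra.
Qed.

(** The iterate of index [S n] is close to the limit by the error bound, and close to the image of
    the limit by contraction. Both errors vanish as [n] grows. *)
Lemma picard_lim_fixed t : picard_lim t = picard_step picard_lim t.
Proof.
  apply dist1_eq0. apply Rnot_lt_le; intros Hpos.
  destruct (geometric_small (2 * picard_cst * weight t) _ Hpos) as [n Hn].
  apply (Rlt_irrefl (dist1 (picard_lim t) (picard_step picard_lim t))).
  apply Rle_lt_trans with (2 := Hn).
  apply Rle_trans with (1 := dist1_triangle _ (picard (S n) t) _).
  pose proof (picard_lim_bound (S n) t) as H1.
  assert (H2 : dist1 (picard_step (picard n) t) (picard_step picard_lim t)
                 <= 2 * picard_cst / 2 ^ n / 2 * weight t).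
  { apply picard_step_contract.
    - apply picard_continuous.
    - apply picard_lim_continuous.
    - apply Rdiv_le_0_compat; [pose proof picard_cst_pos; lra | apply pow_lt; lra].
    - intros s. rewrite dist1_sym. apply picard_lim_bound. }
  change (picard (S n) t) with (picard_step (picard n) t) in *.
  replace (2 * picard_cst / 2 ^ S n) with (2 * picard_cst / 2 ^ n / 2) in H1
    by (simpl; field; apply pow_nonzero; lra).
  replace (2 * picard_cst * weight t / 2 ^ n) with
    (2 * picard_cst / 2 ^ n / 2 * weight t + 2 * picard_cst / 2 ^ n / 2 * weight t)
    by (field; apply pow_nonzero; lra).
  lra.
Qed.

End Picard.

Lemma picard_lindelof (F G : R * R -> R) (L a b : R) :
  0 < L -> Lipschitz1 L F -> Lipschitz1 L G ->
  exists x y : R -> R, x 0 = a /\ y 0 = b /\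
    forall t, 0 <= t ->
      is_derive x t (F (x t, y t)) /\ is_derive y t (G (x t, y t)).
Proof.
  intros HL HF HG.
  set (X := picard_lim F G (a, b)).
  assert (HX : planar_continuous X) by now apply (picard_lim_continuous F G L).
  (* The solution is rebuilt from integrals up to [t] rather than [Rabs t]. It agrees with [X] for
     [t >= 0], but has a two-sided derivative at 0, which the even function [X] may lack. *)
  exists (fun t => a + RInt (fun s => F (X s)) 0 t),
         (fun t => b + RInt (fun s => G (X s)) 0 t).
  split; [ | split].
  1,2: rewrite RInt_point; apply Rplus_0_r.
  intros t Ht.
  assert (E : (a + RInt (fun s => F (X s)) 0 t, b + RInt (fun s => G (X s)) 0 t) = X t).
  { pose proof (picard_lim_fixed F G L (a, b) HL HF HG t) as Hfix.
    fold X in Hfix. rewrite Hfix. unfold picard_step. simpl.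
    now rewrite (Rabs_pos_eq t Ht). }
  rewrite E.
  assert (Hd : forall c H, Lipschitz1 L H ->
             is_derive (fun t => c + RInt (fun s => H (X s)) 0 t) t (H (X t))).
  { intros c H HH.
    replace (H (X t)) with (plus zero (H (X t))) by apply Rplus_0_l.
    apply (is_derive_plus (K := R_AbsRing) (V := R_NormedModule)).
    - apply (is_derive_const (K := R_AbsRing) (V := R_NormedModule)).
    - apply (is_derive_RInt_continuous (fun s => H (X s))).
      now apply (Lipschitz1_continuous L). }
  auto.
Qed.

(** * Real functions and powers *)

Lemma increment_le (f f' : R -> R) (a b m : R) :
  a <= b -> (forall t, a <= t <= b -> is_derive f t (f' t)) ->
  (forall t, a <= t <= b -> f' t <= m) -> f b - f a <= m * (b - a).
Proof.
  intros Hab Hd Hm.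
  destruct (MVT_gen f a b f') as [c [Hc E]].
  - intros t Ht. rewrite Rmin_left, Rmax_right in Ht by easy. apply Hd; lra.
  - intros t Ht. rewrite Rmin_left, Rmax_right in Ht by easy.
    apply continuity_pt_filterlim.
    apply (ex_derive_continuous (V := R_NormedModule)). exists (f' t). auto.
  - rewrite Rmin_left, Rmax_right in Hc by easy. rewrite E.
    apply Rmult_le_compat_r; [lra | auto].
Qed.

Lemma increment_ge (f f' : R -> R) (a b m : R) :
  a <= b -> (forall t, a <= t <= b -> is_derive f t (f' t)) ->
  (forall t, a <= t <= b -> m <= f' t) -> m * (b - a) <= f b - f a.
Proof.
  intros Hab Hd Hm.
  pose proof (increment_le (fun t => - f t) (fun t => - f' t) a b (- m) Hab) as H.
  assert (- f b - - f a <= - m * (b - a)); [ | lra].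
  apply H; intros t Ht.
  - apply (is_derive_opp (K := R_AbsRing) (V := R_NormedModule)); auto.
  - specialize (Hm t Ht). lra.
Qed.

(** This drives the continuation arguments below: a strict inequality either persists forever or
    fails at a first time, at which it has become an equality. *)
Lemma first_zero (f : R -> R) (a : R) :
  (forall t, a <= t -> continuous f t) -> 0 < f a ->
  (forall t, a <= t -> 0 < f t) \/
  (exists T, a < T /\ f T = 0 /\ forall t, a <= t < T -> 0 < f t).
Proof.
  intros Hc Ha.
  destruct (classic (forall t, a <= t -> 0 < f t)) as [H | H]; [now left | right].
  apply not_all_ex_not in H as [b Hb].
  apply imply_to_and in Hb as [Hab Hfb].
  set (S := fun t => a <= t /\ forall s, a <= s <= t -> 0 < f s).
  assert (HS : forall t, S t -> t < b).
  { intros t [_ Ht]. apply Rnot_le_lt; intros Hbt. apply Hfb, Ht. lra. }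
  destruct (completeness S) as [T [HT1 HT2]].
  - exists b. intros t Ht. left. auto.
  - exists a. split; [lra | ]. intros s Hs. replace s with a by lra. easy.
  - assert (HaT : a <= T).
    { apply HT1. split; [lra | ]. intros s Hs. replace s with a by lra. easy. }
    assert (Hlt : forall t, a <= t < T -> 0 < f t).
    { intros t Ht. apply Rnot_le_lt; intros Hft.
      enough (T <= t) by lra.
      apply HT2. intros s [_ Hs]. apply Rnot_lt_le; intros Hts.
      specialize (Hs t ltac:(lra)). lra. }
    pose proof (proj1 (continuous_eps f T) (Hc T HaT)) as HcT.
    (* Continuity leaves only [f T = 0]: a negative value would spread to points left of [T], where
       [f] is positive, and a positive one would let [S] extend beyond its supremum. *)
    destruct (Rtotal_order (f T) 0) as [Hn | [H0 | Hp]].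
    + destruct (HcT (- f T) ltac:(lra)) as [[d Hd] Hloc]; simpl in Hloc.
      destruct (Req_dec a T) as [-> | Hne]; [lra | ].
      set (t := Rmax a (T - d / 2)).
      assert (Ht : a <= t < T /\ T - t <= d / 2).
      { unfold t. pose proof (Rmax_l a (T - d / 2)). pose proof (Rmax_r a (T - d / 2)).
        split; [split; [easy | apply Rmax_lub_lt; lra] | lra]. }
      assert (Hbt : ball T d t).
      { change (Rabs (t - T) < d). rewrite Rabs_left; lra. }
      specialize (Hloc t Hbt). specialize (Hlt t (proj1 Ht)).
      apply Rabs_def2 in Hloc. lra.
    + exists T. repeat split; auto.
      destruct HaT as [HaT | ->]; [easy | lra].
    + destruct (HcT (f T) Hp) as [[d Hd] Hloc]; simpl in Hloc.
      enough (T + d / 2 <= T) by lra.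
      apply HT1. split; [lra | ].
      intros s Hs. destruct (Rlt_le_dec s T) as [HsT | HsT]; [apply Hlt; lra | ].
      assert (Hbs : ball T d s).
      { change (Rabs (s - T) < d). rewrite Rabs_pos_eq; lra. }
      specialize (Hloc s Hbs). apply Rabs_def2 in Hloc. lra.
Qed.

Lemma abs_pow_0 (a : R) : abs_pow 0 a = 0.
Proof. unfold abs_pow. destruct (Req_EM_T 0 0); [easy | now elim n]. Qed.

Lemma abs_pow_neq0 (x a : R) : x <> 0 -> abs_pow x a = Rpower (Rabs x) a.
Proof. intros H. unfold abs_pow. now destruct (Req_EM_T x 0). Qed.

Lemma abs_pow_opp (x a : R) : abs_pow (- x) a = abs_pow x a.
Proof.
  destruct (Req_dec x 0) as [-> | H]; [now rewrite Ropp_0 | ].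
  rewrite !abs_pow_neq0 by lra. now rewrite Rabs_Ropp.
Qed.

Lemma abs_pow_ge0 (x a : R) : 0 <= abs_pow x a.
Proof.
  unfold abs_pow. destruct (Req_EM_T x 0); [lra | left; apply exp_pos].
Qed.

Lemma abs_pow_incr (x y a : R) :
  0 < a -> Rabs x <= Rabs y -> abs_pow x a <= abs_pow y a.
Proof.
  intros Ha Hxy. destruct (Req_dec x 0) as [-> | Hx].
  - rewrite abs_pow_0. apply abs_pow_ge0.
  - pose proof (Rabs_pos_lt x Hx).
    assert (y <> 0) by (intros ->; rewrite Rabs_R0 in Hxy; lra).
    rewrite !abs_pow_neq0 by easy. apply Rle_Rpower_l; lra.
Qed.

Lemma abs_pow_root (c a : R) : 0 < c -> a <> 0 -> abs_pow (Rpower c (/ a)) a = c.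
Proof.
  intros Hc Ha. assert (0 < Rpower c (/ a)) by apply exp_pos.
  rewrite abs_pow_neq0 by lra. rewrite Rabs_pos_eq by lra.
  rewrite Rpower_mult, Rinv_l by easy. now apply Rpower_1.
Qed.

Lemma locally_pos (x : R) : 0 < x -> locally x (fun y => 0 < y).
Proof. intros H. exact (open_gt 0 x H). Qed.

Lemma continuous_abs_pow (a x : R) : 0 < a -> continuous (fun x => abs_pow x a) x.
Proof.
  intros Ha. destruct (Req_dec x 0) as [-> | Hx].
  - apply continuous_eps. intros eps He.
    assert (Hr : 0 < Rpower eps (/ a)) by apply exp_pos.
    exists (mkposreal _ Hr). intros s Hs.
    change (Rabs (s - 0) < Rpower eps (/ a)) in Hs.
    rewrite abs_pow_0, Rminus_0_r, Rabs_pos_eq by apply abs_pow_ge0.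
    rewrite Rminus_0_r in Hs.
    destruct (Req_dec s 0) as [-> | Hn]; [now rewrite abs_pow_0 | ].
    rewrite abs_pow_neq0 by easy.
    pose proof (Rabs_pos_lt s Hn).
    replace eps with (Rpower (Rpower eps (/ a)) a).
    + apply Rlt_Rpower_l; lra.
    + rewrite Rpower_mult, Rinv_l by lra. now apply Rpower_1.
  - pose proof (Rabs_pos_lt x Hx).
    apply (continuous_ext_loc _ (fun x => Rpower (Rabs x) a)).
    + assert (Hl : locally x (fun y => 0 < Rabs y))
        by (apply (continuous_Rabs x (fun z => 0 < z)), locally_pos; easy).
      revert Hl; apply filter_imp. intros y Hy.
      rewrite abs_pow_neq0; [easy | ]. intros ->. rewrite Rabs_R0 in Hy. lra.
    + apply (continuous_comp Rabs (fun z => Rpower z a)); [apply continuous_Rabs | ].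
      apply (ex_derive_continuous (V := R_NormedModule)).
      unfold Rpower. auto_derive. easy.
Qed.

(** The power rule gives [x > 0], and oddness gives [x < 0]. At 0 the difference quotient is
    [abs_pow h a] itself, which tends to 0. *)
Lemma is_derive_id_mult_abs_pow (a x : R) :
  0 < a -> is_derive (fun x => x * abs_pow x a) x ((1 + a) * abs_pow x a).
Proof.
  intros Ha.
  assert (Hpos : forall x, 0 < x ->
            is_derive (fun x => x * abs_pow x a) x ((1 + a) * abs_pow x a)).
  { intros y Hy.
    apply (is_derive_ext_loc (fun z => z * Rpower z a)).
    - generalize (locally_pos y Hy); apply filter_imp. intros z Hz.
      rewrite abs_pow_neq0, Rabs_pos_eq by lra. easy.
    - rewrite abs_pow_neq0, Rabs_pos_eq by lra.
      unfold Rpower. auto_derive; [easy | field; lra]. }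
  destruct (Rtotal_order x 0) as [Hx | [-> | Hx]]; [ | | auto].
  - assert (E : forall y, - ((- y) * abs_pow (- y) a) = y * abs_pow y a)
      by (intros y; rewrite abs_pow_opp; ring).
    apply (is_derive_ext _ _ _ _ E).
    specialize (Hpos (- x) ltac:(lra)). rewrite abs_pow_opp in Hpos.
    replace ((1 + a) * abs_pow x a) with (opp (scal (-1) ((1 + a) * abs_pow x a)))
      by (unfold scal, opp; simpl; unfold mult; simpl; ring).
    apply (is_derive_opp (K := R_AbsRing) (V := R_NormedModule)).
    apply (is_derive_comp (fun x => x * abs_pow x a) Ropp); [exact Hpos | ].
    auto_derive; [easy | ring].
  - rewrite abs_pow_0, Rmult_0_r. apply is_derive_Reals.
    intros eps He.
    pose proof (proj1 (continuous_eps _ _) (continuous_abs_pow a 0 Ha) eps He) as [d Hd].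
    exists d. intros h Hh Hhd.
    rewrite Rplus_0_l, Rmult_0_l.
    replace ((h * abs_pow h a - 0) / h - 0) with (abs_pow h a - abs_pow 0 a)
      by (rewrite abs_pow_0; field; easy).
    apply Hd. change (Rabs (h - 0) < d). now rewrite Rminus_0_r.
Qed.

(** * Truncated system *)

(** The derivative is only required to be positive inside the interval, since in the climbing
    argument the velocity may vanish at the final time. *)
Lemma increment_pos (f f' : R -> R) (a b : R) :
  a < b -> (forall t, a <= t <= b -> is_derive f t (f' t)) ->
  (forall t, a < t < b -> 0 < f' t) -> f a < f b.
Proof.
  intros Hab Hd Hm.
  destruct (MVT_cor2 f f' a b Hab) as [c [E Hc]].
  - intros t Ht. apply is_derive_Reals. auto.
  - specialize (Hm c Hc). nra.
Qed.

(** A Barbalat-type argument. If [Rabs (w t) >= eps] at a late time, the slope bound [B] keeps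
    [Rabs w] above [eps / 2] for a duration [h]. This costs at least [d] of energy, more than is
    left once [E] is within [d] of its infimum. *)
Lemma dissipation_limit (w wd E Ed : R -> R) (T eta B m : R) :
  0 < eta -> 0 < B ->
  (forall t, T <= t -> is_derive w t (wd t) /\ Rabs (wd t) <= B) ->
  (forall t, T <= t -> is_derive E t (Ed t) /\ Ed t <= - (eta * w t ^ 2)) ->
  (forall t, T <= t -> m <= E t) ->
  is_lim w p_infty 0.
Proof.
  intros Heta HB Hw HE Hm.
  assert (Hdecr : forall t u, T <= t -> t <= u -> E u <= E t).
  { intros t u Ht Hu.
    pose proof (increment_le E Ed t u 0 Hu) as H.
    enough (E u - E t <= 0 * (u - t)) by lra.
    apply H; intros r Hr; destruct (HE r ltac:(lra)) as [H1 H2]; [easy | ].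
    pose proof (pow2_ge_0 (w r)). nra. }
  (* Since [completeness] provides suprema, [l] is minus the infimum of [E] after [T]. *)
  destruct (completeness (fun x => exists t, T <= t /\ x = - E t)) as [l [Hl1 Hl2]].
  { exists (- m). intros x [t [Ht ->]]. specialize (Hm t Ht). lra. }
  { exists (- E T), T. split; [lra | easy]. }
  apply is_lim_spec. intros [eps Heps]; simpl.
  set (h := eps / (2 * B)). assert (HBh : B * h = eps / 2) by (unfold h; field; lra).
  set (d := eta * (eps / 2) ^ 2 * h).
  assert (Hh : 0 < h) by (apply Rdiv_lt_0_compat; lra).
  assert (Hd : 0 < d).
  { apply Rmult_lt_0_compat; [apply Rmult_lt_0_compat; [ | apply pow_lt] | ]; lra. }
  assert (Hex : exists t0, T <= t0 /\ l - d < - E t0).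
  { apply NNPP. intros Hn.
    enough (l <= l - d) by lra.
    apply Hl2. intros x [t [Ht ->]]. apply Rnot_lt_le. intros Hlt.
    apply Hn. now exists t. }
  destruct Hex as [t0 [Ht0 Hl0]]. exists t0. intros t Ht.
  rewrite Rminus_0_r. apply Rnot_le_lt; intros Hge.
  assert (Hlarge : forall r, t <= r <= t + h -> eps / 2 <= Rabs (w r)).
  { intros r Hr.
    pose proof (increment_le w wd t r B ltac:(lra)) as H1.
    pose proof (increment_ge w wd t r (- B) ltac:(lra)) as H2.
    assert (HwB : forall u, t <= u <= r -> - B <= wd u <= B).
    { intros u Hu. apply Rabs_le_between. apply Hw. lra. }
    assert (Hwd : forall u, t <= u <= r -> is_derive w u (wd u)).
    { intros u Hu. apply Hw. lra. }
    specialize (H1 Hwd (fun u Hu => proj2 (HwB u Hu))).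
    specialize (H2 Hwd (fun u Hu => proj1 (HwB u Hu))).
    assert (B * (r - t) <= eps / 2).
    { rewrite <- HBh.
      apply Rmult_le_compat_l; lra. }
    assert (Rabs (w r - w t) <= eps / 2) by (apply Rabs_le; lra).
    pose proof (Rabs_triang_inv (w t) (w r)).
    rewrite Rabs_minus_sym in H3. lra. }
  assert (Hdrop : E (t + h) - E t <= - (eta * (eps / 2) ^ 2) * (t + h - t)).
  { apply (increment_le E Ed); [lra | | ].
    - intros r Hr. apply HE. lra.
    - intros r Hr. destruct (HE r ltac:(lra)) as [_ H]. specialize (Hlarge r Hr).
      assert ((eps / 2) ^ 2 <= w r ^ 2).
      { rewrite <- (pow2_abs (w r)). apply pow_incr. lra. }
      nra. }
  assert (- E (t + h) <= l) by (apply Hl1; exists (t + h); split; [lra | easy]).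
  pose proof (Hdecr t0 t Ht0 ltac:(lra)).
  unfold d in Hl0. nra.
Qed.

Definition clamp (M x : R) : R := Rmax (- M) (Rmin M x).

Lemma clamp_bounds M x : 0 <= M -> - M <= clamp M x <= M.
Proof. intros HM. unfold clamp, Rmax, Rmin. repeat destruct Rle_dec; lra. Qed.

Lemma clamp_id M x : - M <= x <= M -> clamp M x = x.
Proof. intros Hx. unfold clamp, Rmax, Rmin. repeat destruct Rle_dec; lra. Qed.

Lemma clamp_Lipschitz M x y : 0 <= M -> Rabs (clamp M x - clamp M y) <= Rabs (x - y).
Proof.
  intros HM. unfold clamp, Rmax, Rmin, Rabs.
  repeat destruct Rle_dec; repeat destruct Rcase_abs; lra.
Qed.

Lemma clamp_sqr_le M x : 0 <= M -> clamp M x ^ 2 <= x ^ 2.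
Proof. intros HM. unfold clamp, Rmax, Rmin. repeat destruct Rle_dec; nra. Qed.

Lemma id_mult_abs_pow_Lipschitz (a M x y : R) :
  0 < a -> - M <= x <= M -> - M <= y <= M ->
  Rabs (x * abs_pow x a - y * abs_pow y a) <= (1 + a) * abs_pow M a * Rabs (x - y).
Proof.
  intros Ha Hx Hy.
  assert (H : forall x y, - M <= x -> x <= y -> y <= M ->
     0 <= y * abs_pow y a - x * abs_pow x a <= (1 + a) * abs_pow M a * (y - x)).
  { clear x y Hx Hy. intros x y Hx Hxy Hy. split.
    - replace 0 with (0 * (y - x)) by ring.
      apply (increment_ge (fun x => x * abs_pow x a) (fun x => (1 + a) * abs_pow x a));
        [easy | | ]; intros t Ht.
      + now apply is_derive_id_mult_abs_pow.
      + pose proof (abs_pow_ge0 t a). nra.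
    - apply (increment_le (fun x => x * abs_pow x a) (fun x => (1 + a) * abs_pow x a));
        [easy | | ]; intros t Ht.
      + now apply is_derive_id_mult_abs_pow.
      + apply Rmult_le_compat_l; [lra | ]. apply abs_pow_incr; [easy | ].
        rewrite (Rabs_pos_eq M) by lra. apply Rabs_le. lra. }
  destruct (Rle_dec x y) as [Hxy | Hxy].
  - specialize (H x y ltac:(lra) Hxy ltac:(lra)).
    rewrite (Rabs_minus_sym x y), (Rabs_pos_eq (y - x)) by lra.
    rewrite Rabs_minus_sym, Rabs_pos_eq; lra.
  - specialize (H y x ltac:(lra) ltac:(lra) ltac:(lra)).
    rewrite (Rabs_pos_eq (x - y)) by lra. rewrite Rabs_pos_eq; lra.
Qed.

(* Lienard coordinates w = v - y^2/2 make the damping term y w the derivative of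
   y^2/2; only the first coordinate enters nonlinearly, so truncating it makes
   the field globally Lipschitz. *)
Lemma truncated_orbit (p lambda M s : R) :
  1 < p -> 0 < lambda -> 0 < M ->
  exists y yd w : R -> R, y 0 = 0 /\ w 0 = s /\
    (forall t, 0 <= t -> is_derive y t (yd t) /\ w t <= yd t /\ continuous w t) /\
    (forall t, 0 <= t -> - M <= y t <= M ->
       yd t = w t /\
       is_derive w t (lambda * y t - y t * abs_pow (y t) (p - 1) - y t * w t)).
Proof.
  intros Hp Hl HM.
  set (F := fun P : R * R => snd P - clamp M (fst P) ^ 2 / 2).
  set (G := fun P : R * R => lambda * clamp M (fst P)
              - clamp M (fst P) * abs_pow (clamp M (fst P)) (p - 1)).
  (* The summands are the slopes of [v], of the clamped [y^2 / 2], of the linear term and of the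
     power term on [-M, M]. *)
  set (L := 1 + M + lambda + p * abs_pow M (p - 1)).
  pose proof (abs_pow_ge0 M (p - 1)) as HA.
  assert (HpA : 0 <= p * abs_pow M (p - 1)) by nra.
  assert (HF : Lipschitz1 L F).
  { intros [a b] [a' b']. unfold F, dist1; simpl fst; simpl snd.
    pose proof (clamp_Lipschitz M a a' ltac:(lra)) as Hc.
    pose proof (clamp_bounds M a ltac:(lra)) as B1.
    pose proof (clamp_bounds M a' ltac:(lra)) as B2.
    set (c := clamp M a) in *. set (c' := clamp M a') in *.
    replace (b - c ^ 2 / 2 - (b' - c' ^ 2 / 2)) with
      ((b - b') - (c + c') / 2 * (c - c')) by field.
    apply Rle_trans with (1 := Rabs_triang _ _).
    rewrite Rabs_Ropp, Rabs_mult.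
    assert (Hs : Rabs ((c + c') / 2) <= M) by (apply Rabs_le; lra).
    pose proof (Rabs_pos (b - b')). pose proof (Rabs_pos (c - c')).
    pose proof (Rmult_le_compat _ _ _ _ (Rabs_pos ((c + c') / 2)) H0 Hs Hc).
    unfold L. nra. }
  assert (HG : Lipschitz1 L G).
  { intros [a b] [a' b']. unfold G, dist1; simpl fst; simpl snd.
    pose proof (clamp_Lipschitz M a a' ltac:(lra)) as Hc.
    pose proof (clamp_bounds M a ltac:(lra)) as B1.
    pose proof (clamp_bounds M a' ltac:(lra)) as B2.
    set (c := clamp M a) in *. set (c' := clamp M a') in *.
    pose proof (id_mult_abs_pow_Lipschitz (p - 1) M c c' ltac:(lra) B1 B2) as Hphi.
    replace (1 + (p - 1)) with p in Hphi by ring.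
    replace (lambda * c - c * abs_pow c (p - 1) - (lambda * c' - c' * abs_pow c' (p - 1)))
      with (lambda * (c - c') - (c * abs_pow c (p - 1) - c' * abs_pow c' (p - 1))) by ring.
    apply Rle_trans with (1 := Rabs_triang _ _).
    rewrite Rabs_Ropp, Rabs_mult, (Rabs_pos_eq lambda) by lra.
    pose proof (Rabs_pos (b - b')). pose proof (Rabs_pos (c - c')).
    unfold L. nra. }
  destruct (picard_lindelof F G L 0 s) as [y [v [Hy0 [Hv0 Hder]]]]; auto; [unfold L; lra | ].
  (* Back from Lienard coordinates. The unclamped [y] is used here, so [w] equals the velocity only
     while the orbit stays in the strip. *)
  set (w := fun t => v t - y t ^ 2 / 2).
  assert (Hw : forall t, 0 <= t -> is_derive w t (G (y t, v t) - y t * F (y t, v t))).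
  { intros t Ht. destruct (Hder t Ht) as [H1 H2]. unfold w.
    auto_derive; [repeat split; eexists; eauto | ].
    apply is_derive_unique in H1, H2. simpl.
    change (fun x : R => v x) with v. change (fun x : R => y x) with y.
    rewrite H1, H2. field. }
  exists y, (fun t => F (y t, v t)), w.
  split; [easy | split; [ | split]].
  - unfold w. rewrite Hy0, Hv0. field.
  - intros t Ht. split; [now apply Hder | split].
    (* Clamping can only shrink [y^2], hence [w <= yd] with no bound on [y]. Growth of [y] can thus
       be deduced from [w > 0] before [y] is known to lie in the strip. *)
    + unfold w, F; simpl fst; simpl snd.
      pose proof (clamp_sqr_le M (y t) ltac:(lra)). lra.
    + apply (ex_derive_continuous (V := R_NormedModule)). eexists. now apply Hw.
  - intros t Ht Hy. split.
    + unfold w, F; simpl fst; simpl snd. now rewrite clamp_id.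
    + replace (lambda * y t - y t * abs_pow (y t) (p - 1) - y t * w t)
        with (G (y t, v t) - y t * F (y t, v t)); [now apply Hw | ].
      unfold w, F, G; simpl fst; simpl snd. now rewrite clamp_id.
Qed.

(** * Energy and trapping *)

(** The factor [y^2] is pulled out of the potential so that its sign is that of the bracket, and so
    that only the power [p - 1] of the equation occurs. *)
Definition energy (p lambda y w : R) : R :=
  w ^ 2 / 2 + y ^ 2 * (abs_pow y (p - 1) / (p + 1) - lambda / 2).

Lemma energy_derive (p lambda : R) (y w : R -> R) (t : R) :
  1 < p -> is_derive y t (w t) ->
  is_derive w t (lambda * y t - y t * abs_pow (y t) (p - 1) - y t * w t) ->
  is_derive (fun t => energy p lambda (y t) (w t)) t (- (y t * w t ^ 2)).
Proof.
  intros Hp Hy Hw.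
  set (P := fun x => x * abs_pow x (p - 1)).
  assert (HP : is_derive P (y t) ((1 + (p - 1)) * abs_pow (y t) (p - 1)))
    by (apply is_derive_id_mult_abs_pow; lra).
  apply (is_derive_ext (fun t => w t ^ 2 / 2 + y t * P (y t) / (p + 1)
                                 - lambda * y t ^ 2 / 2)).
  { intros r. unfold energy, P. simpl. field. lra. }
  auto_derive.
  - repeat split; eexists; eauto.
  - apply is_derive_unique in Hy, Hw, HP.
    change (fun x : R => w x) with w. change (fun x : R => y x) with y.
    change (fun x : R => P x) with P.
    rewrite Hy, Hw, HP. unfold P. field. lra.
Qed.

Section Trapping.

(** Up to height [delta] the potential is at most [- lambda / 4 * y^2]; [M] is its positive zero.
    [k] is the slope of the line [w = k y] above which orbits of nonnegative energy climb, and [Hsk]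
    says that climbing to [delta] would cost more than the initial energy. *)
Variables (p lambda s delta M k : R) (y yd w : R -> R).
Hypotheses (Hp : 1 < p) (Hl : 0 < lambda) (Hs : 0 < s)
  (Hdelta : 0 < delta) (Hdelta_pow : abs_pow delta (p - 1) = lambda / 2)
  (HdM : delta < M) (HM_pow : abs_pow M (p - 1) = (p + 1) * (lambda / 2))
  (Hk : 0 < k) (Hk2 : k ^ 2 = lambda / 2) (Hsk : s ^ 2 / 2 < k * delta ^ 3 / 3)
  (Hy0 : y 0 = 0) (Hw0 : w 0 = s)
  (Hy : forall t, 0 <= t -> is_derive y t (yd t) /\ w t <= yd t /\ continuous w t)
  (Hw : forall t, 0 <= t -> - M <= y t <= M ->
     yd t = w t /\
     is_derive w t (lambda * y t - y t * abs_pow (y t) (p - 1) - y t * w t)).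

Let E t := energy p lambda (y t) (w t).

Lemma orbit_energy_derive t :
  0 <= t -> - M <= y t <= M -> is_derive E t (- (y t * w t ^ 2)).
Proof.
  intros Ht HyM. destruct (Hw t Ht HyM) as [E1 E2].
  apply energy_derive; auto. rewrite <- E1. now apply Hy.
Qed.

(** The bracket in [energy] is at most [- lambda / 4], because the power is at most [lambda / 2] and
    [p + 1 > 2]. The kinetic term has to compensate. *)
Lemma energy_small_lower x v :
  0 <= x <= delta -> 0 <= energy p lambda x v -> (k * x) ^ 2 <= v ^ 2.
Proof.
  intros Hx HE. unfold energy in HE.
  assert (HA : abs_pow x (p - 1) / (p + 1) <= lambda / 4).
  { apply Rmult_le_reg_r with (p + 1); [lra | ].
    replace (abs_pow x (p - 1) / (p + 1) * (p + 1)) with (abs_pow x (p - 1)) by (field; lra).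
    apply Rle_trans with (lambda / 2); [ | nra].
    rewrite <- Hdelta_pow. apply abs_pow_incr; [lra | ].
    rewrite !Rabs_pos_eq; lra. }
  replace ((k * x) ^ 2) with (k ^ 2 * x ^ 2) by ring. rewrite Hk2.
  pose proof (pow2_ge_0 x). nra.
Qed.

(** Read backwards, a negative energy keeps [x] away from 0; this later makes the damping
    coefficient uniformly positive. *)
Lemma energy_lower x v : - (lambda / 2) * x ^ 2 <= energy p lambda x v.
Proof.
  unfold energy.
  pose proof (pow2_ge_0 x). pose proof (pow2_ge_0 v).
  assert (0 <= abs_pow x (p - 1) / (p + 1))
    by (apply Rdiv_le_0_compat; [apply abs_pow_ge0 | lra]).
  nra.
Qed.

Lemma energy_exit v : 0 <= energy p lambda 0 v /\ 0 <= energy p lambda M v.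
Proof.
  unfold energy. rewrite HM_pow. pose proof (pow2_ge_0 v). split.
  - lra.
  - replace ((p + 1) * (lambda / 2) / (p + 1) - lambda / 2) with 0 by (field; lra). lra.
Qed.

(* As long as the energy is nonnegative, w >= k y, hence dE/dy = - y w <= - k y^2. *)
Lemma climb T :
  0 < T -> (forall t, 0 <= t < T -> 0 < w t) ->
  (forall t, 0 <= t <= T -> 0 <= w t /\ y t <= delta) ->
  (forall t, 0 < t <= T -> 0 <= E t) ->
  (forall t, 0 < t <= T -> 0 < y t) /\
  (forall t, 0 <= t <= T -> k * y t <= w t) /\
  E T + k * y T ^ 3 / 3 <= s ^ 2 / 2.
Proof.
  intros HT Hwpos Hclosed HE.
  assert (Hypos : forall t, 0 < t <= T -> 0 < y t).
  { intros t Ht. rewrite <- Hy0. apply (increment_pos y yd); [lra | | ]; intros r Hr.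
    - apply Hy; lra.
    - destruct (Hy r ltac:(lra)) as [_ [H _]]. specialize (Hwpos r ltac:(lra)). lra. }
  assert (Hkw : forall t, 0 <= t <= T -> k * y t <= w t).
  { intros t Ht. destruct (Hclosed t Ht) as [H1 H2].
    destruct (Req_dec t 0) as [-> | Hn]; [rewrite Hy0; lra | ].
    specialize (Hypos t ltac:(lra)). specialize (HE t ltac:(lra)).
    pose proof (energy_small_lower (y t) (w t) ltac:(lra) HE).
    apply Rnot_lt_le; intros Hlt. assert (0 < k * y t) by nra. nra. }
  split; [easy | split; [easy | ]].
  assert (HyM : forall t, 0 <= t <= T -> 0 <= y t <= M).
  { intros t Ht. split; [ | apply Rle_trans with delta; [now apply Hclosed | lra]].
    destruct (Req_dec t 0) as [-> | Hn]; [lra | ]. left. apply Hypos. lra. }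
  (* The bound on dE/dy in integrated form: [E + k y^3 / 3] has derivative [- y w (w - k y) <= 0]
     and starts at [s^2 / 2]. *)
  assert (H : (E T + k * y T ^ 3 / 3) - (E 0 + k * y 0 ^ 3 / 3) <= 0 * (T - 0)).
  { apply (increment_le (fun t => E t + k * y t ^ 3 / 3)
       (fun t => - (y t * w t ^ 2) + k * y t ^ 2 * w t)); [lra | | ]; intros t Ht.
    - specialize (HyM t Ht).
      apply (is_derive_plus (K := R_AbsRing) (V := R_NormedModule)).
      + apply orbit_energy_derive; lra.
      + destruct (Hw t ltac:(lra) ltac:(lra)) as [Eq _].
        destruct (Hy t ltac:(lra)) as [Hyd _]. rewrite Eq in Hyd.
        auto_derive; [eexists; eauto | ].
        apply is_derive_unique in Hyd. change (fun x : R => y x) with y.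
        rewrite Hyd. field.
    - specialize (HyM t Ht). specialize (Hkw t Ht). destruct (Hclosed t Ht) as [Hwt _].
      replace (- (y t * w t ^ 2) + k * y t ^ 2 * w t)
        with (- (y t * w t * (w t - k * y t))) by ring.
      assert (0 <= y t * w t * (w t - k * y t)); [ | lra].
      apply Rmult_le_pos; [apply Rmult_le_pos | ]; lra. }
  assert (E0 : E 0 = s ^ 2 / 2) by (unfold E, energy; rewrite Hy0, Hw0; simpl; lra).
  rewrite E0, Hy0 in H. simpl in H |- *. lra.
Qed.

(** Otherwise [climb] applies throughout. Then [w >= k y > 0] forbids turning back, and [y] must
    reach [delta], where the accumulated loss contradicts [Hsk]. *)
Lemma negative_energy :
  exists T, 0 < T /\ (forall t, 0 < t <= T -> 0 < y t <= delta) /\ E T < 0.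
Proof.
  apply NNPP. intros Hno.
  assert (Hneg : forall T, 0 < T -> (forall t, 0 < t <= T -> 0 < y t <= delta) -> 0 <= E T).
  { intros T HT H. apply Rnot_lt_le; intros HE. apply Hno. now exists T. }
  assert (Hclimb : forall T, 0 < T -> (forall t, 0 <= t < T -> 0 < w t) ->
    (forall t, 0 <= t <= T -> 0 <= w t /\ y t <= delta) ->
    (forall t, 0 < t <= T -> 0 < y t) /\
    (forall t, 0 <= t <= T -> k * y t <= w t) /\
    E T + k * y T ^ 3 / 3 <= s ^ 2 / 2).
  { intros T HT H1 H2. apply climb; auto. intros t Ht. apply Hneg; [lra | ].
    intros r Hr. split; [ | apply H2; lra].
    rewrite <- Hy0. apply (increment_pos y yd); [lra | | ]; intros q Hq.
    - apply Hy; lra.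
    - destruct (Hy q ltac:(lra)) as [_ [H _]]. specialize (H1 q ltac:(lra)). lra. }
  set (g := fun t => delta - y t).
  (* twice the minimum of w and g *)
  set (f := fun t => w t + g t - Rabs (w t - g t)).
  assert (Hf : forall t, (0 < f t <-> 0 < w t /\ 0 < g t) /\
                         (f t = 0 -> 0 <= w t /\ 0 <= g t /\ (w t = 0 \/ g t = 0))).
  { intros t. unfold f, Rabs. destruct Rcase_abs; (split; [split | ]); intros; lra. }
  destruct (first_zero f 0) as [Hall | [T [HT [HfT Hlt]]]].
  - intros t Ht. destruct (Hy t Ht) as [H1 [_ H2]].
    assert (Hg : continuous g t).
    { apply (continuous_minus (V := R_NormedModule)); [apply continuous_const | ].
      apply (ex_derive_continuous (V := R_NormedModule)). now exists (yd t). }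
    apply (continuous_minus (V := R_NormedModule)).
    + now apply (continuous_plus (V := R_NormedModule)).
    + apply (continuous_comp (fun t => w t - g t) Rabs); [ | apply continuous_Rabs].
      now apply (continuous_minus (V := R_NormedModule)).
  - apply Hf. unfold g. rewrite Hw0, Hy0. lra.
  - assert (Hpos : forall t, 0 <= t -> 0 < w t /\ y t < delta).
    { intros t Ht. pose proof (proj1 (proj1 (Hf t)) (Hall t Ht)). unfold g in *. lra. }
    assert (Hcl : forall T, 0 < T ->
      (forall t, 0 < t <= T -> 0 < y t) /\ (forall t, 0 <= t <= T -> k * y t <= w t) /\
      E T + k * y T ^ 3 / 3 <= s ^ 2 / 2).
    { intros T HT. apply Hclimb; auto; intros t Ht; specialize (Hpos t ltac:(lra)); lra. }
    assert (Hy1 : 0 < y 1) by (apply (Hcl 1); lra).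
    assert (Hd : 0 < delta / (k * y 1)).
    { apply Rdiv_lt_0_compat; [easy | ]. now apply Rmult_lt_0_compat. }
    (* From time 1 on, [y] grows at rate at least [k * y 1], so by time [N] it has gained [delta]
       and overshoots the assumed bound. *)
    set (N := 1 + delta / (k * y 1)).
    assert (HN : k * y 1 * (N - 1) <= y N - y 1).
    { apply (increment_ge y yd); [unfold N; lra | | ]; intros t Ht;
        destruct (Hy t ltac:(lra)) as [H1 [H2 _]]; [easy | ].
      apply Rle_trans with (2 := H2).
      apply Rle_trans with (k * y t); [ | now apply (Hcl t); lra].
      apply Rmult_le_compat_l; [lra | ].
      assert (0 * (t - 1) <= y t - y 1); [ | lra].
      apply (increment_ge y yd); [lra | | ]; intros r Hr;
        destruct (Hy r ltac:(lra)) as [H3 [H4 _]]; [easy | ].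
      pose proof (Hpos r ltac:(lra)). lra. }
    replace (k * y 1 * (N - 1)) with delta in HN by (unfold N; field; lra).
    destruct (Hpos N ltac:(unfold N; lra)). lra.
  - assert (Hw_lt : forall t, 0 <= t < T -> 0 < w t) by (intros t Ht; now apply Hf, Hlt).
    assert (Hle : forall t, 0 <= t <= T -> 0 <= w t /\ y t <= delta).
    { intros t Ht. destruct (Req_dec t T) as [-> | Hn].
      - destruct (proj2 (Hf T) HfT) as [H1 [H2 _]]. unfold g in H2. lra.
      - destruct (proj1 (proj1 (Hf t)) (Hlt t ltac:(lra))). unfold g in *. lra. }
    destruct (Hclimb T HT Hw_lt Hle) as [H1 [H2 H3]].
    assert (Hin : forall t, 0 < t <= T -> 0 < y t <= delta).
    { intros t Ht. split; [now apply H1 | apply Hle; lra]. }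
    pose proof (Hneg T HT Hin) as HET.
    specialize (H1 T ltac:(lra)). specialize (H2 T ltac:(lra)).
    (* The alternative [w T = 0] is excluded by [w T >= k * y T > 0]. *)
    assert (HyT : y T = delta).
    { destruct (proj2 (Hf T) HfT) as [_ [_ [H | H]]]; unfold g in *; nra. }
    rewrite HyT in H3. lra.
Qed.

Lemma trapped :
  exists T, 0 < T /\ E T < 0 /\ (forall t, 0 < t <= T -> 0 < y t <= M) /\
    forall t, T <= t -> 0 < y t < M /\ E t <= E T.
Proof.
  destruct negative_energy as [T [HT [Hbelow HET]]].
  exists T. split; [easy | split; [easy | split]].
  { intros t Ht. specialize (Hbelow t Ht). lra. }
  assert (Hdecr : forall t, T <= t -> (forall r, T <= r <= t -> 0 <= y r <= M) -> E t <= E T).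
  { intros t Ht Hr.
    enough (E t - E T <= 0 * (t - T)) by lra.
    apply (increment_le E (fun t => - (y t * w t ^ 2))); [easy | | ]; intros r Hrt;
      specialize (Hr r Hrt).
    - apply orbit_energy_derive; lra.
    - pose proof (pow2_ge_0 (w r)). nra. }
  (* The product turns the two barriers 0 and [M] into a single scalar condition, to which
     [first_zero] applies. *)
  assert (Hf : forall t, 0 < y t * (M - y t) -> 0 < y t < M).
  { intros t H. split; apply Rnot_le_lt; intros Hle; nra. }
  destruct (first_zero (fun t => y t * (M - y t)) T) as [Hall | [T1 [HT1 [Hz Hlt]]]].
  - intros t Ht.
    assert (continuous y t).
    { apply (ex_derive_continuous (V := R_NormedModule)). exists (yd t). apply Hy. lra. }
    apply (continuous_mult (K := R_AbsRing)); [easy | ].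
    apply (continuous_minus (V := R_NormedModule)); [apply continuous_const | easy].
  - specialize (Hbelow T ltac:(lra)). nra.
  - intros t Ht. split; [auto | ]. apply Hdecr; [easy | ].
    intros r Hr. specialize (Hf r (Hall r ltac:(lra))). lra.
  - exfalso.
    assert (Hend : y T1 = 0 \/ y T1 = M).
    { apply Rmult_integral in Hz. lra. }
    assert (HE1 : E T1 <= E T).
    { apply Hdecr; [lra | ]. intros r Hr. destruct (Req_dec r T1) as [-> | Hn]; [lra | ].
      specialize (Hf r (Hlt r ltac:(lra))). lra. }
    destruct (energy_exit (w T1)) as [Ex1 Ex2].
    unfold E in HE1, HET. destruct Hend as [H | H]; rewrite H in HE1; lra.
Qed.

Lemma orbit_properties :
  (forall t, 0 < t -> 0 < y t) /\ (forall t, 0 <= t -> - M <= y t <= M) /\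
  is_lim w p_infty 0.
Proof.
  destruct trapped as [T [HT [HET [Hbefore Hafter]]]].
  assert (Hpos : forall t, 0 < t -> 0 < y t <= M).
  { intros t Ht. destruct (Rle_dec t T); [apply Hbefore; lra | ].
    destruct (Hafter t ltac:(lra)). lra. }
  assert (HyM : forall t, 0 <= t -> - M <= y t <= M).
  { intros t Ht. destruct (Req_dec t 0) as [-> | Hn]; [lra | ].
    specialize (Hpos t ltac:(lra)). lra. }
  split; [ | split; [easy | ]]; [intros t Ht; now apply Hpos | ].
  (* Negative energy and the lower bound on the potential give [w^2 <= lambda * M^2]; adding 1 gives
     a bound for [Rabs w] without a square root. *)
  set (W := 1 + lambda * M ^ 2).
  assert (HM2 : 0 < lambda * M ^ 2) by (apply Rmult_lt_0_compat; [ | apply pow_lt]; lra).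
  assert (HA : 0 <= abs_pow M (p - 1)) by apply abs_pow_ge0.
  assert (Hbound : forall t, T <= t -> Rabs (w t) <= W).
  { intros t Ht. destruct (Hafter t Ht) as [HyT HEt].
    assert (Hw2 : w t ^ 2 <= lambda * M ^ 2).
    { pose proof (energy_lower (y t) 0) as HG. fold (E t) in *.
      assert (HE : E t = w t ^ 2 / 2 + energy p lambda (y t) 0)
        by (unfold E, energy; field; lra).
      assert (y t ^ 2 <= M ^ 2) by (apply pow_incr; lra).
      nra. }
    unfold W. apply Rabs_le. split; nra. }
  (* A lower bound for [y] after [T]: [E T >= E t >= - (lambda / 2) * y^2 >= - (lambda / 2) * M *
     y]. *)
  set (eta := - 2 * E T / (lambda * M)).
  assert (Heta : 0 < eta) by (apply Rdiv_lt_0_compat; nra).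
  apply (dissipation_limit w
    (fun t => lambda * y t - y t * abs_pow (y t) (p - 1) - y t * w t)
    E (fun t => - (y t * w t ^ 2)) T eta
    (lambda * M + M * abs_pow M (p - 1) + M * W) (- (lambda / 2) * M ^ 2)); auto.
  - unfold W. assert (0 < lambda * M) by nra. nra.
  - intros t Ht. split; [apply Hw; [lra | apply HyM; lra] | ].
    destruct (Hafter t Ht) as [HyT _].
    pose proof (Hbound t Ht) as HwW.
    assert (HAt : abs_pow (y t) (p - 1) <= abs_pow M (p - 1)).
    { apply abs_pow_incr; [lra | ]. rewrite !Rabs_pos_eq; lra. }
    pose proof (abs_pow_ge0 (y t) (p - 1)) as HA0.
    apply Rle_trans with (1 := Rabs_triang _ _). rewrite Rabs_Ropp, Rabs_mult.
    rewrite (Rabs_pos_eq (y t)) by lra.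
    apply Rplus_le_compat.
    + apply Rle_trans with (1 := Rabs_triang _ _). rewrite Rabs_Ropp, !Rabs_mult.
      rewrite (Rabs_pos_eq (y t)), (Rabs_pos_eq lambda), (Rabs_pos_eq (abs_pow _ _)) by lra.
      apply Rplus_le_compat; [nra | ]. apply Rmult_le_compat; lra.
    + apply Rmult_le_compat; try lra. apply Rabs_pos.
  - intros t Ht. destruct (Hafter t Ht) as [HyT HEt].
    split; [apply orbit_energy_derive; lra | ].
    apply Ropp_le_contravar, Rmult_le_compat_r; [apply pow2_ge_0 | ].
    pose proof (energy_lower (y t) (w t)) as HG. fold (E t) in HG.
    apply Rmult_le_reg_r with (lambda * M); [nra | ].
    unfold eta. replace (-2 * E T / (lambda * M) * (lambda * M)) with (- 2 * E T)
      by (field; lra).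
    assert (lambda * y t * y t <= lambda * y t * M) by (apply Rmult_le_compat_l; nra).
    nra.
  - intros t Ht. destruct (Hafter t Ht) as [HyT _].
    apply Rle_trans with (2 := energy_lower (y t) (w t)).
    assert (y t ^ 2 <= M ^ 2) by (apply pow_incr; lra). nra.
Qed.

End Trapping.

Lemma damped_orbit (p lambda : R) :
  1 < p -> 0 < lambda ->
  exists y w : R -> R, y 0 = 0 /\ (forall t, 0 < t -> 0 < y t) /\
    (forall t, 0 <= t -> is_derive y t (w t) /\
       is_derive w t (lambda * y t - y t * abs_pow (y t) (p - 1) - y t * w t)) /\
    is_lim w p_infty 0.
Proof.
  intros Hp Hl.
  set (delta := Rpower (lambda / 2) (/ (p - 1))).
  set (M := Rpower ((p + 1) * (lambda / 2)) (/ (p - 1))).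
  set (k := sqrt (lambda / 2)).
  assert (Hk : 0 < k) by (apply sqrt_lt_R0; lra).
  assert (Hk2 : k ^ 2 = lambda / 2) by (apply pow2_sqrt; lra).
  assert (Hd : 0 < delta) by apply exp_pos.
  assert (HdM : delta < M).
  { apply Rlt_Rpower_l; [apply Rinv_0_lt_compat; lra | nra]. }
  set (d := k * delta ^ 3 / 3).
  assert (Hd3 : 0 < d).
  { unfold d. apply Rdiv_lt_0_compat; [ | lra].
    apply Rmult_lt_0_compat; [ | apply pow_lt]; easy. }
  (* [s <= 1] gives [s^2 / 2 <= s / 2], which is below [d] since [s <= d]. *)
  set (s := Rmin 1 d).
  assert (Hs : 0 < s) by (apply Rmin_glb_lt; lra).
  assert (Hsd : s ^ 2 / 2 < d).
  { pose proof (Rmin_l 1 d : s <= 1). pose proof (Rmin_r 1 d : s <= d). nra. }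
  destruct (truncated_orbit p lambda M s Hp Hl) as [y [yd [w [Hy0 [Hw0 [Hy Hw]]]]]]; [lra | ].
  destruct (orbit_properties p lambda s delta M k y yd w) as [Hpos [HM Hlim]]; auto.
  1,2: apply abs_pow_root; nra.
  exists y, w. repeat (split; [easy | ]). split; [ | easy].
  intros t Ht. destruct (Hw t Ht (HM t Ht)) as [Eq Hwd]. split; [ | easy].
  rewrite <- Eq. now apply Hy.
Qed.

(** * From the oscillator to the equation *)

Lemma limit1_in_of_continuous (f : R -> R) (D : R -> Prop) (x : R) :
  continuous f x -> limit1_in f D (f x) x.
Proof.
  intros H eps He. destruct (proj1 (continuous_eps f x) H eps He) as [d Hd].
  exists d. split; [apply cond_pos | ]. intros y [_ Hy]. exact (Hd y Hy).
Qed.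

Lemma D_in_of_is_derive (f f' : R -> R) (D : R -> Prop) (x : R) :
  is_derive f x (f' x) -> D_in f f' D x.
Proof.
  intros H. apply is_derive_Reals in H. intros eps He.
  destruct (H eps He) as [d Hd]. exists d. split; [apply cond_pos | ].
  intros y [[_ Hyx] Hy]. simpl in *. unfold Rdist in *.
  specialize (Hd (y - x) ltac:(lra) Hy). now rewrite Rplus_minus in Hd.
Qed.

(** Two-sided derivatives restrict to any [I]. The second derivative is read off from the equation,
    so its continuity is that of the right-hand side, where [p > 1] makes the power continuous at
    0. *)
Lemma solution_of_is_derive (p lambda : R) (I : R -> Prop) (u u' : R -> R) :
  1 < p ->
  (forall x, I x -> is_derive u x (u' x) /\
     is_derive u' x (u x * u' x - u x * abs_pow (u x) (p - 1) + lambda * u x)) ->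
  solution_on p lambda I u u'.
Proof.
  intros Hp H.
  exists (fun x => u x * u' x - u x * abs_pow (u x) (p - 1) + lambda * u x).
  split; [ | intros x _; ring].
  split; [ | split]; intros x Hx; destruct (H x Hx) as [H1 H2].
  1,2: now apply D_in_of_is_derive.
  assert (C1 : continuous u x)
    by (apply (ex_derive_continuous (V := R_NormedModule)); eexists; eauto).
  assert (C2 : continuous u' x)
    by (apply (ex_derive_continuous (V := R_NormedModule)); eexists; eauto).
  apply (limit1_in_of_continuous
    (fun x => u x * u' x - u x * abs_pow (u x) (p - 1) + lambda * u x)).
  apply (continuous_plus (V := R_NormedModule));
    [apply (continuous_minus (V := R_NormedModule)) | ];
    apply (continuous_mult (K := R_AbsRing)); auto using continuous_const.
  apply (continuous_comp u (fun z => abs_pow z (p - 1))); [easy | ].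
  apply continuous_abs_pow; lra.
Qed.

Lemma is_derive_eq (f : R -> R) (x l l' : R) :
  is_derive f x l -> l = l' -> is_derive f x l'.
Proof. now intros H <-. Qed.

(** At the junction [g] and [h] both have derivative [f' a], and each difference quotient of [f] is
    one of [g] or of [h], so the smaller of the two radii works. *)
Lemma is_derive_glue (f f' g g' h h' : R -> R) (a : R) :
  (forall x, x <= a -> f x = g x /\ f' x = g' x /\ is_derive g x (g' x)) ->
  (forall x, a <= x -> f x = h x /\ f' x = h' x /\ is_derive h x (h' x)) ->
  forall x, is_derive f x (f' x).
Proof.
  intros Hg Hh x. destruct (Rtotal_order x a) as [Hx | [-> | Hx]].
  - destruct (Hg x ltac:(lra)) as [_ [-> Dg]].
    apply (is_derive_ext_loc g); [ | easy].
    generalize (open_lt a x Hx); apply filter_imp. intros y Hy.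
    symmetry. apply Hg. now left.
  - destruct (Hg a ltac:(lra)) as [_ [E Dg]]. destruct (Hh a ltac:(lra)) as [_ [E' Dh]].
    rewrite <- E in Dg. rewrite <- E' in Dh.
    apply is_derive_Reals in Dg, Dh. apply is_derive_Reals.
    intros eps He. destruct (Dg eps He) as [d1 H1]. destruct (Dh eps He) as [d2 H2].
    assert (Hd : 0 < Rmin d1 d2) by (apply Rmin_glb_lt; apply cond_pos).
    exists (mkposreal _ Hd). intros x Hx Hxd; simpl in Hxd.
    pose proof (Rmin_l d1 d2). pose proof (Rmin_r d1 d2).
    destruct (Rle_dec x 0).
    + rewrite (proj1 (Hg (a + x) ltac:(lra))), (proj1 (Hg a ltac:(lra))). apply H1; lra.
    + rewrite (proj1 (Hh (a + x) ltac:(lra))), (proj1 (Hh a ltac:(lra))). apply H2; lra.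
  - destruct (Hh x ltac:(lra)) as [_ [-> Dh]].
    apply (is_derive_ext_loc h); [ | easy].
    generalize (open_gt a x Hx); apply filter_imp. intros y Hy.
    symmetry. apply Hh. now left.
Qed.

Lemma is_derive_comp_opp (f : R -> R) (x l : R) :
  is_derive f (- x) l -> is_derive (fun x => f (- x)) x (- l).
Proof.
  intros H. auto_derive; [eexists; eauto | ].
  apply is_derive_unique in H. change (fun x : R => f x) with f. rewrite H. ring.
Qed.

Lemma is_derive_opp_R (f : R -> R) (x l : R) :
  is_derive f x l -> is_derive (fun x => - f x) x (- l).
Proof. apply (is_derive_opp (K := R_AbsRing) (V := R_NormedModule)). Qed.

Lemma is_lim_comp_opp_m_infty (f : R -> R) :
  is_lim f p_infty 0 -> is_lim (fun x => - f (- x)) m_infty 0.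
Proof.
  intros H. apply is_lim_spec in H. apply is_lim_spec. intros eps.
  destruct (H eps) as [A HA]. exists (- A). intros x Hx.
  specialize (HA (- x) ltac:(lra)). rewrite Rminus_0_r in *. now rewrite Rabs_Ropp.
Qed.

Lemma is_lim_opp_p_infty (f : R -> R) :
  is_lim f p_infty 0 -> is_lim (fun x => - f x) p_infty 0.
Proof.
  intros H. apply is_lim_opp in H. simpl in H. now rewrite Ropp_0 in H.
Qed.

Theorem theorem2p8 (p lambda : R) (hp : 1 < p) (hlambda : 0 < lambda) :
  (exists u u' : R -> R,
     solution_on p lambda nonpos_line u u' /\ positive_on nonpos_line u /\
     is_lim u' m_infty 0 /\ u' 0 = 0) /\
  (exists v v' : R -> R,
     solution_on p lambda nonpos_line v v' /\ positive_on nonpos_line v /\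
     is_lim v' m_infty 0 /\ v 0 = 0) /\
  (exists w w' : R -> R,
     solution_on p lambda whole_line w w' /\ sign_changing_on whole_line w /\
     is_lim w' m_infty 0 /\ is_lim w' p_infty 0) /\
  (exists z z' : R -> R,
     solution_on p lambda nonneg_line z z' /\ negative_on nonneg_line z /\
     z 0 = 0 /\ is_lim z' p_infty 0).
Proof.
  destruct (damped_orbit p lambda hp hlambda) as [y [w [Hy0 [Hpos [Hder Hlim]]]]].
  set (r := fun t => lambda * y t - y t * abs_pow (y t) (p - 1) - y t * w t) in *.
  assert (Hleft : forall x, x <= 0 -> is_derive (fun x => y (- x)) x (- w (- x)) /\
                    is_derive (fun x => - w (- x)) x (r (- x))).
  { intros x Hx. destruct (Hder (- x) ltac:(lra)) as [H1 H2]. split.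
    - now apply is_derive_comp_opp.
    - rewrite <- (Ropp_involutive (r (- x))).
      apply is_derive_opp_R. now apply is_derive_comp_opp. }
  assert (Hright : forall x, 0 <= x -> is_derive (fun x => - y x) x (- w x) /\
                    is_derive (fun x => - w x) x (- r x)).
  { intros x Hx. destruct (Hder x Hx) as [H1 H2]. split; now apply is_derive_opp_R. }
  repeat apply conj.
  - set (c := Rpower lambda (/ (p - 1))).
    exists (fun _ => c), (fun _ => 0). repeat apply conj; try easy.
    + apply solution_of_is_derive; [easy | ]. intros x _. split.
      * apply (is_derive_const (K := R_AbsRing) (V := R_NormedModule)).
      * apply (is_derive_eq _ _ 0).
        -- apply (is_derive_const (K := R_AbsRing) (V := R_NormedModule)).
        -- unfold c. rewrite abs_pow_root by lra. ring.
    + intros x _. apply exp_pos.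
    + apply is_lim_const.
  - exists (fun x => y (- x)), (fun x => - w (- x)). repeat apply conj.
    + apply solution_of_is_derive; [easy | ]. intros x Hx.
      destruct (Hleft x Hx) as [H1 H2]. split; [easy | ].
      apply (is_derive_eq _ _ _ _ H2). unfold r. ring.
    + intros x [d Hd]. apply Hpos.
      (* A point of the ball to the right of [x] still lies in the half-line, which makes [x < 0]
         strict. *)
      specialize (Hd (x + d / 2)). unfold disc, nonpos_line in Hd.
      pose proof (cond_pos d). rewrite Rplus_minus_l, Rabs_pos_eq in Hd by lra.
      specialize (Hd ltac:(lra)). lra.
    + now apply is_lim_comp_opp_m_infty.
    + now rewrite Ropp_0.
  - set (W := fun x => if Rle_dec x 0 then y (- x) else - y x).
    set (W' := fun x => if Rle_dec x 0 then - w (- x) else - w x).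
    assert (WL : forall x, x <= 0 -> W x = y (- x) /\ W' x = - w (- x)).
    { intros x Hx. unfold W, W'. now destruct (Rle_dec x 0). }
    assert (WR : forall x, 0 <= x -> W x = - y x /\ W' x = - w x).
    { intros x Hx. unfold W, W'. destruct (Rle_dec x 0); [ | easy].
      replace x with 0 by lra. rewrite Ropp_0, Hy0. split; ring. }
    exists W, W'. repeat apply conj.
    + apply solution_of_is_derive; [easy | ]. intros x _.
      split; revert x.
      * apply (is_derive_glue _ _ (fun x => y (- x)) (fun x => - w (- x))
                 (fun x => - y x) (fun x => - w x) 0); intros x Hx.
        -- split; [now apply WL | split; [now apply WL | now apply Hleft]].
        -- split; [now apply WR | split; [now apply WR | now apply Hright]].
      (* The one-sided second derivatives [r 0] and [- r 0] agree because every term of [r] carries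
         a factor [y], which vanishes at 0. *)
      * apply (is_derive_glue _
                 (fun x => W x * W' x - W x * abs_pow (W x) (p - 1) + lambda * W x)
                 (fun x => - w (- x)) (fun x => r (- x))
                 (fun x => - w x) (fun x => - r x) 0); intros x Hx.
        -- destruct (WL x Hx) as [E E']. split; [easy | split; [ | now apply Hleft]].
           rewrite E, E'. unfold r. ring.
        -- destruct (WR x Hx) as [E E']. split; [easy | split; [ | now apply Hright]].
           rewrite E, E', abs_pow_opp. unfold r. ring.
    + exists (-1). split; [easy | ]. rewrite (proj1 (WL (-1) ltac:(lra))). apply Hpos. lra.
    + exists 1. split; [easy | ]. rewrite (proj1 (WR 1 ltac:(lra))).
      specialize (Hpos 1 ltac:(lra)). lra.
    + apply (is_lim_ext_loc (fun x => - w (- x))); [ | now apply is_lim_comp_opp_m_infty].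
      exists 0. intros x Hx. symmetry. apply WL. lra.
    + apply (is_lim_ext_loc (fun x => - w x)); [ | now apply is_lim_opp_p_infty].
      exists 0. intros x Hx. symmetry. apply WR. lra.
  - exists (fun x => - y x), (fun x => - w x). repeat apply conj.
    + apply solution_of_is_derive; [easy | ]. intros x Hx.
      destruct (Hright x Hx) as [H1 H2]. split; [easy | ].
      apply (is_derive_eq _ _ _ _ H2). rewrite abs_pow_opp. unfold r. ring.
    + intros x [d Hd]. enough (0 < y x) by lra. apply Hpos.
      specialize (Hd (x - d / 2)). unfold disc, nonneg_line in Hd.
      pose proof (cond_pos d).
      replace (x - d / 2 - x) with (- (d / 2)) in Hd by ring.
      rewrite Rabs_Ropp, Rabs_pos_eq in Hd by lra.
      specialize (Hd ltac:(lra)). lra.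
    + rewrite Hy0. ring.
    + now apply is_lim_opp_p_infty.
Qed.
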